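(* Let $n \in \mathbb{N}$ and let $\epsilon = (\epsilon_1,\dots,\epsilon_n)$ be a sequentially dependent categorical sequence of length $n$ with $K$ categories. Then $P(\epsilon_j = i) = p_i$ for all $i = 1,\dots,K$ and all $j = 1,\dots,n$.
   Context: Fix a number of categories $K \in \mathbb{N}$, probabilities $p_1,\dots,p_K \geq 0$ with $\sum_{i=1}^K p_i = 1$, and a dependency coefficient $0 \leq \delta \leq 1$. Put $p_j^{+} = p_j + \delta(1-p_j)$ and $p_j^{-} = p_j - \delta p_j$ for $j = 1,\dots,K$. A sequence $(\epsilon_1,\dots,\epsilon_n)$ of random variables with values in $\{1,\dots,K\}$ is a sequentially dependent categorical sequence (with these parameters) if $P(\epsilon_1 = i) = p_i$ and, for $l \geq 2$, $P(\epsilon_l \mid \epsilon_1,\dots,\epsilon_{l-1}) = P(\epsilon_l \mid \epsilon_{l-1})$, with $P(\epsilon_l = j \mid \epsilon_{l-1} = j) = p_j^{+}$ and $P(\epsilon_l = j \mid \epsilon_{l-1} = i) = p_j^{-}$ for $i \neq j$. Equivalently, for $\omega \in \{1,\dots,K\}^n$, $$P\big((\epsilon_1,\dots,\epsilon_n) = \omega\big) = p_{\omega_1}\prod_{l=2}^{n} t(\omega_{l-1},\omega_l),$$ where $t(j,j) = p_j^{+}$ and $t(i,j) = p_j^{-}$ for $i \neq j$. *)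

(* Defs.v *)
From mathcomp Require Import all_boot all_order all_algebra.
From mathcomp Require Import all_classical all_reals all_analysis.

Set Implicit Arguments.
Unset Strict Implicit.
Unset Printing Implicit Defensive.

Import Order.TTheory GRing.Theory Num.Theory.

Local Open Scope classical_set_scope.
Local Open Scope ring_scope.

Definition p_plus (R : realType) (K : nat) (p : 'I_K -> R) (delta : R)
  (j : 'I_K) : R := p j + delta * (1 - p j).

Definition p_minus (R : realType) (K : nat) (p : 'I_K -> R) (delta : R)
  (j : 'I_K) : R := p j - delta * p j.

(* Only meaningful when P B != 0; every use below is guarded accordingly. *)
Definition cond_prob d (T : measurableType d) (R : realType)
  (P : probability T R) (A B : set T) : R :=
  fine (P (A `&` B)) / fine (P B).

(* Categories 1, ..., K and times 1, ..., n are 'I_K and 'I_n (0-based);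
   [l = m.+1 :> nat] says that m is the time just before l.  The first field
   says that each eps l is a random variable with values in 'I_K, discrete
   sigma-algebra; it is spelled out because {RV P >-> _} needs a pointed
   codomain, which 'I_K is not for a variable K.  In the Markov field, equality
   of the conditional laws of the discrete variable eps l is required at every
   history of positive probability, i.e. almost surely. *)
Record sdc_sequence d (T : measurableType d) (R : realType)
    (P : probability T R) (K n : nat) (p : 'I_K -> R) (delta : R)
    (eps : 'I_n -> T -> 'I_K) : Prop := SDCSequence {
  sdc_measurable : forall (l : 'I_n) (A : set 'I_K),
    measurable (eps l @^-1` A) ;
  sdc_initial : forall (l : 'I_n) (i : 'I_K), l = 0 :> nat ->
    P (eps l @^-1` [set i]) = (p i)%:E ;
  sdc_markov : forall (m l : 'I_n) (x : 'I_n -> 'I_K) (j : 'I_K),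
    l = m.+1 :> nat ->
    let history := [set w | forall k : 'I_n, (k < l)%N -> eps k w = x k] in
    P history != 0%E ->
    cond_prob P (eps l @^-1` [set j]) history =
    cond_prob P (eps l @^-1` [set j]) (eps m @^-1` [set x m]) ;
  sdc_transition_same : forall (m l : 'I_n) (j : 'I_K), l = m.+1 :> nat ->
    P (eps m @^-1` [set j]) != 0%E ->
    cond_prob P (eps l @^-1` [set j]) (eps m @^-1` [set j]) =
    p_plus p delta j ;
  sdc_transition_diff : forall (m l : 'I_n) (i j : 'I_K), l = m.+1 :> nat ->
    i != j -> P (eps m @^-1` [set i]) != 0%E ->
    cond_prob P (eps l @^-1` [set j]) (eps m @^-1` [set i]) =
    p_minus p delta j
}.

(* Main.v *)
(* Induction on time.  The transition probability from k to i is
   [(1 - delta) * p i + delta * (k == i)], a mixture of a fresh draw from p and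
   a copy of the previous value; both preserve the law p.  The joint
   probabilities of consecutive values are used instead of the conditional
   ones, so that categories with [p k = 0] need no exclusion. *)
Require Import Defs.
From mathcomp Require Import all_boot all_order all_algebra.
From mathcomp Require Import all_classical all_reals all_analysis.
From mathcomp Require Import ring.

Import Order.TTheory GRing.Theory Num.Theory.

Local Open Scope classical_set_scope.
Local Open Scope ring_scope.

(** The fibres of [X] are disjoint, finite in number and cover [T], so additivity of [P] applies.
    Passing through [fine] puts the sum in [R], where [cond_prob] takes its values. *)
Lemma total_probability d (T : measurableType d) (R : realType)
    (P : probability T R) (I : finType) (X : T -> I) (A : set T) :
  measurable A -> (forall k, measurable (X @^-1` [set k])) ->
  fine (P A) = \sum_k fine (P (A `&` X @^-1` [set k])).
Proof.
move=> mA mX.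
have mAX k : measurable (A `&` X @^-1` [set k]) by exact: measurableI.
rewrite sum_fine; last by move=> k _; exact: fin_num_measure.
have {1}-> : A = \bigcup_(k in [set: I]) (A `&` X @^-1` [set k]).
  by apply/seteqP; split=> [w Aw|w [k _ []]//]; exists (X w).
rewrite measure_fin_bigcup//=; last exact: trivIset_preimage1_in.
rewrite [in RHS]fsbig_seq ?index_enum_uniq//.
congr fine; apply: eq_fsbigl.
by apply/seteqP; split=> // k _ /=; rewrite mem_index_enum.
Qed.

Lemma marginal_step d (T : measurableType d) (R : realType)
    (P : probability T R) (K n : nat) (p : 'I_K -> R) (delta : R)
    (eps : 'I_n -> T -> 'I_K) (m l : 'I_n) :
  sdc_sequence P p delta eps -> l = m.+1 :> nat ->
  \sum_(i < K) p i = 1 ->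
  (forall k, P (eps m @^-1` [set k]) = (p k)%:E) ->
  forall i, P (eps l @^-1` [set i]) = (p i)%:E.
Proof.
move=> [meps _ _ tsame tdiff] lm p1 Pm i.
(* One formula covers both transitions, since [p_plus] exceeds [p_minus] by exactly [delta]. *)
have joint k : fine (P (eps l @^-1` [set i] `&` eps m @^-1` [set k])) =
    (p_minus p delta i + delta * (k == i)%:R) * p k.
  (* If [p k = 0], the joint event lies in a null set and both sides vanish; otherwise the
     conditional probability is multiplied by [p k]. *)
  have [pk0|pk0] := eqVneq (p k) 0.
    suff -> : P (eps l @^-1` [set i] `&` eps m @^-1` [set k]) = 0%E.
      by rewrite pk0 mulr0.
    apply: (@subset_measure0 _ _ _ P _ (eps m @^-1` [set k])) => //.
    - by apply: measurableI; exact: meps.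
    - by apply: etrans (Pm k) _; rewrite pk0.
  have Pm0 : P (eps m @^-1` [set k]) != 0%E by rewrite Pm eqe.
  have [ki|ki] := eqVneq k i.
    have := tsame m l i lm; rewrite -ki => /(_ Pm0).
    rewrite /cond_prob Pm /= => /(canRL (divfK pk0)) ->.
    by rewrite /p_plus /p_minus; ring.
  have := tdiff m l k i lm ki Pm0.
  rewrite /cond_prob Pm /= => /(canRL (divfK pk0)) ->.
  by rewrite mulr0 addr0.
rewrite -[LHS]fineK; last exact: fin_num_measure.
congr EFin; rewrite (@total_probability _ _ _ _ _ (eps m))//.
(* The first summand adds up to [p_minus p delta i], as the [p k] sum to 1; the second survives only
   at [k = i], giving back the missing [delta * p i]. *)
under eq_bigr do rewrite joint mulrDl.
rewrite big_split /= -mulr_sumr p1 (bigD1 i)//= big1 => [|k /negPf ->].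
  by rewrite eqxx /p_minus mulr1n; ring.
by rewrite mulr0 mul0r.
Qed.

Theorem lemma1 (R : realType) (K : nat) (p : 'I_K -> R) (delta : R)
    (p_ge0 : forall i : 'I_K, 0 <= p i) (p_sum1 : \sum_(i < K) p i = 1)
    (delta_ge0 : 0 <= delta) (delta_le1 : delta <= 1)
    (d : measure_display) (T : measurableType d) (P : probability T R)
    (n : nat) (eps : 'I_n -> T -> 'I_K)
    (eps_sdc : sdc_sequence P p delta eps) (j : 'I_n) (i : 'I_K) :
  P (eps j @^-1` [set i]) = (p i)%:E.
Proof.
case: j => j; elim: j i => [|j IHj] i jn; first exact: (sdc_initial eps_sdc).
(* Here [jn] is [j.+1 < n], so [ltnW jn] proves [j.+1 <= n], which is [j < n]: the previous time is
   a valid index. *)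
by apply: (marginal_step _ _ _ _ _ _ _ _ _ (Ordinal (ltnW jn)) _ eps_sdc).
Qed.
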